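(* Let $n\ge 2$ and let $VQ_n$ be the $n$-dimensional varietal hypercube. Then every edge of $VQ_n$ is contained in a cycle of length $\ell$ for every integer $\ell$ with $4\le \ell\le 2^n$ and $\ell\ne 5$. Consequently, for $n\ge 3$, $VQ_n$ is $6$-edge-pancyclic, i.e. every edge lies on cycles of every length from $6$ to $2^n$.
   Context: The $n$-dimensional varietal hypercube $VQ_n$ is defined recursively on the vertex set of binary strings of length $n$. $VQ_1$ is the complete graph on the two vertices $0$ and $1$. For $n>1$, let $VQ^0_{n-1}$ (resp. $VQ^1_{n-1}$) be the graph obtained from $VQ_{n-1}$ by prefixing $0$ (resp. $1$) to every vertex label. $VQ_n$ consists of $VQ^0_{n-1}$ and $VQ^1_{n-1}$ together with the following edges: a vertex $x=0x_{n-1}x_{n-2}\cdots x_1$ and a vertex $y=1y_{n-1}y_{n-2}\cdots y_1$ are adjacent if and only if either (1) $n$ is not a multiple of $3$ and $x_{n-1}\cdots x_1=y_{n-1}\cdots y_1$, or (2) $n$ is a multiple of $3$, $x_{n-3}\cdots x_1=y_{n-3}\cdots y_1$ and $(x_{n-1}x_{n-2},y_{n-1}y_{n-2})\in\{(00,00),(01,01),(10,11),(11,10)\}$. A graph is $\ell$-edge-pancyclic if every edge lies on cycles of every length from $\ell$ to the number of vertices. Cycles are simple. *)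

(* Defs.v *)
From mathcomp Require Export all_boot.

Set Implicit Arguments.
Unset Strict Implicit.
Unset Printing Implicit Defensive.

Section Cycles.

Variables (T : finType) (e : rel T).

(* [ucycle e c] holds for [::], for one looped vertex and for two adjacent
   vertices, so the length bound is needed to get graph cycles. *)
Definition simple_cycle (c : seq T) : Prop :=
  3 <= size c /\ ucycle e c.

(* [next c z] is the successor of [z] in the cyclic order of [c]. *)
Definition edge_in_cycle (x y : T) (c : seq T) : Prop :=
  [/\ x \in c, y \in c & next c x = y \/ next c y = x].

Definition edge_on_cycle_of_length (x y : T) (l : nat) : Prop :=
  exists c : seq T, [/\ simple_cycle c, size c = l & edge_in_cycle x y c].

Definition edge_pancyclic (l : nat) : Prop :=
  forall x y : T, e x y ->
  forall k : nat, l <= k <= #|T| -> edge_on_cycle_of_length x y k.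

End Cycles.

(* The string x_n x_(n-1) ... x_1 is the sequence [:: x_n; ...; x_1], with
   [false] for 0 and [true] for 1. *)

(* The allowed pairs (x_(n-1) x_(n-2), y_(n-1) y_(n-2)) when 3 divides n. *)
Definition vq_pairs : seq (seq bool * seq bool) :=
  [:: ([:: false; false], [:: false; false]);
      ([:: false; true],  [:: false; true]);
      ([:: true; false],  [:: true; true]);
      ([:: true; true],   [:: true; false])].

(* Adjacency in VQ_n of 0u and 1v, for u and v of length n - 1. *)
Definition vq_cross (n : nat) (u v : seq bool) : bool :=
  if 3 %| n then (drop 2 u == drop 2 v) && ((take 2 u, take 2 v) \in vq_pairs)
  else u == v.

(* Only meaningful on two strings of the same length n, which is recovered as
   [size x]. *)
Fixpoint vq_adj (x y : seq bool) : bool :=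
  match x, y with
  | [:: a], [:: b] => a != b
  | a :: u, b :: v =>
      match a, b with
      | false, true => vq_cross (size x) u v
      | true, false => vq_cross (size x) v u
      | _, _ => vq_adj u v
      end
  | _, _ => false
  end.

Definition VQ (n : nat) : rel (n.-tuple bool) := fun x y => vq_adj x y.
Arguments VQ n : clear implicits.

Lemma vq_adj_sym x y : size x = size y -> vq_adj x y = vq_adj y x.
Proof.
elim: x y => [|a u IHu] [|b v] //= [Euv].
have := IHu v Euv; rewrite Euv.
by case: u {IHu} Euv => [|c u]; case: v => [|d v] //= _; case: a; case: b.
Qed.

Lemma VQ_sym n : symmetric (VQ n).
Proof. by move=> x y; apply: vq_adj_sym; rewrite !size_tuple. Qed.

Lemma VQ_irrefl n : irreflexive (VQ n).
Proof.
move=> x; rewrite /VQ; elim: (tval x) => {x} //= a [|b u] IHu; first exact/negbTE/negPn.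
by case: a.
Qed.

(* Main.v *)
Require Import Defs.
From mathcomp Require Import all_boot zify.

(** An edge lies on a cycle of length l iff its ends are joined by a simple path
    with l vertices, and an edge is such a path for l = 2.  By induction on
    n >= 3, adjacent vertices are joined by simple paths with 2, 4, 6, 7, ...,
    2^n vertices.  The two halves of VQ_n are joined by the perfect matching
    u <-> f u, where f is the identity unless 3 divides n, in which case f adds
    the first bit to the second one.  Then f maps every edge uv of VQ_(n-1) to
    an edge, except the edges that flip the first bit; two consecutive edges of
    a path cannot both be such flips.
    For an edge inside one half, take a long path in this half and replace one
    of its preserved edges uv by u, f u, ..., f v, v.  For an edge between the
    halves, join two paths over a preserved edge uv; this gives every length
    except 7, which is not a sum of two lengths from {2, 4, 6, ...}.  The length
    7 comes from a copy of VQ_3 (if 3 divides n) or of VQ_4 containing the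
    edge. *)

(** * Adjacency between the two halves as a perfect matching *)

Definition simple_path (x y : seq bool) (l : nat) : Prop :=
  exists s, [/\ path vq_adj x s, last x s = y, uniq (x :: s) & (size s).+1 = l].

(** This is the map f of the overview. The string [u] labels a vertex of one half, so [(size u).+1]
    is the dimension of the whole cube. *)
Definition vq_twist (u : seq bool) : seq bool :=
  match u with
  | a :: b :: w => if 3 %| (size u).+1 then [:: a, b (+) a & w] else u
  | _ => u
  end.

Lemma size_vq_twist u : size (vq_twist u) = size u.
Proof. by case: u => [|a [|b w]] //=; case: ifP. Qed.

Lemma vq_twistK : involutive vq_twist.
Proof. by case=> [|[] [|[] w]] //=; case: ifP => //= ->. Qed.

Lemma vq_crossE u v : 2 <= size u ->
  vq_cross (size u).+1 u v = (v == vq_twist u).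
Proof.
case: u => [|a [|b w]] //= _; rewrite /vq_cross.
case: ifP => _; last by rewrite eq_sym.
(* The sizes of [u] and [v] may differ here; a [v] with fewer than two bits is excluded because all
   strings in [vq_pairs] have two bits. *)
case: v => [|c [|d z]].
- by rewrite /= take0 [X in _ && X](_ : _ = false) ?andbF //; move: a b => [] [].
- rewrite /= take0 [X in _ && X](_ : _ = false) ?andbF ?eqseq_cons //=.
    by rewrite andbF.
  by move: a b c => [] [] [].
rewrite !eqseq_cons /= !drop0 !take0 (eq_sym z).
by case: (w == z); rewrite ?andbF //; move: a b c d => [] [] [] [].
Qed.

Lemma vq_adj_size x y : vq_adj x y -> size x = size y.
Proof.
elim: x y => [|a u IHu] [|b v] //=; first by case: u {IHu}.
have cross n u' v' : vq_cross n u' v' -> size u' = size v'.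
  rewrite /vq_cross; case: ifP => _; last by move/eqP->.
  case/andP=> /eqP dE tE; rewrite -(cat_take_drop 2 u') -(cat_take_drop 2 v').
  rewrite !size_cat dE; move: tE; rewrite !inE.
  by case/or4P=> /eqP[-> ->].
case: u IHu => [|c u] IHu; case: v => [|d v] //= H; congr _.+1;
  by case: a b H => [] [] // H;
    first [exact: (cross _ _ _ H) | exact: (esym (cross _ _ _ H)) | exact: (IHu (_ :: _) H) | by case: (u) H].
Qed.

Lemma vq_adj_neq x y : vq_adj x y -> x != y.
Proof.
move=> xy; apply/eqP => E; move: xy; rewrite -{}E.
by have:= VQ_irrefl (in_tuple x); rewrite /VQ => ->.
Qed.

Lemma vq_adjE a b u v : 0 < size u ->
  vq_adj (a :: u) (b :: v) =
  if a == b then vq_adj u v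
  else if a then vq_cross (size u).+1 v u else vq_cross (size u).+1 u v.
Proof. by case: u => [|c u] // _; move: a b => [] []. Qed.

Lemma vq_adj_cons a u v : 0 < size u -> vq_adj (a :: u) (a :: v) = vq_adj u v.
Proof. by move=> su; rewrite vq_adjE // eqxx. Qed.

Lemma vq_adj_cross a u v : 2 <= size u ->
  vq_adj (a :: u) (~~ a :: v) = (v == vq_twist u).
Proof.
move=> su; rewrite -(vq_crossE _ _ su).
case: a; case: u su => [|c u] // su.
rewrite [LHS]/=; rewrite (vq_crossE _ _ su).
(* For [a = true] the arguments of [vq_cross] are swapped, so the dimension has to be read off [v].
   If the sizes differ, both sides are false; otherwise the twist is moved across by
   involutivity. *)
case E: (size v == (size u).+1).
  have sv : 2 <= size v by rewrite (eqP E).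
  by rewrite -[(size u).+2]/((size u).+1.+1) -(eqP E) vq_crossE // eq_sym (can2_eq vq_twistK vq_twistK).
apply/idP/eqP => [H|vE]; last by rewrite vE size_vq_twist eqxx in E.
have /vq_adj_size [sE] : vq_adj (true :: c :: u) (false :: v) by [].
by rewrite sE eqxx in E.
Qed.

Lemma vq_crossN3 n u v : ~~ (3 %| n) -> vq_cross n u v = (u == v).
Proof. by rewrite /vq_cross => /negbTE->. Qed.

(** When 3 divides [(size u).+1], it divides neither [size u] nor [size u - 1], so edges changing
    one of the first two bits are plain flips of that bit. Adding the first bit to the second
    commutes with flipping the second bit and with any change in the tail. *)
Lemma vq_adj_twist u v : 3 <= size u -> vq_adj u v ->
  vq_adj (vq_twist u) (vq_twist v) \/ v = ~~ head true u :: behead u.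
Proof.
move=> su uv; have suv := vq_adj_size _ _ uv.
move: u v su suv uv => [|a [|b w]] // [|a' [|b' w']] // sw [sww] aw.
rewrite /vq_twist /= sww; case: ifP => d3; last by left.
move: aw; rewrite !vq_adjE //=; try by move: sw => /=; lia.
rewrite !(vq_crossN3 (size w).+1) ?(vq_crossN3 (size w).+2); try lia.
by case: a a' b b' {sw} => [] [] [] [] //= H; auto;
  first [by left; rewrite eq_sym | by right; case/eqP: H => ->].
Qed.

#[local] Arguments vq_adj : simpl never.

(** * Simple paths *)

Lemma path_size x s : path vq_adj x s -> all (fun y => size y == size x) s.
Proof.
elim: s x => //= y s IHs x /andP[/vq_adj_size -> /IHs ->].
by rewrite eqxx.
Qed.

Lemma path_map_cons a x s : 0 < size x ->
  path vq_adj (a :: x) (map (cons a) s) = path vq_adj x s.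
Proof.
elim: s x => //= y s IHs x sx; rewrite vq_adj_cons //.
by case xy: (vq_adj x y); rewrite // IHs // -(vq_adj_size _ _ xy).
Qed.

Lemma simple_path_adj x y : vq_adj x y -> simple_path x y 2.
Proof. by move=> xy; exists [:: y]; rewrite /= inE xy vq_adj_neq. Qed.

Lemma simple_path_map (f : seq bool -> seq bool) k x y l :
    injective f ->
    (forall u v, size u = k -> vq_adj u v -> vq_adj (f u) (f v)) ->
  size x = k -> simple_path x y l -> simple_path (f x) (f y) l.
Proof.
move=> finj fadj sx [s [ps <- us <-]]; exists (map f s); split.
- elim: s x sx ps {us} => //= z s IHs x sx /andP[xz ps].
  by rewrite fadj //= IHs // -(vq_adj_size _ _ xz).
- by rewrite last_map.
- by rewrite -map_cons map_inj_uniq.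
- by rewrite size_map.
Qed.

Lemma has_map_cons_neq a b (s t : seq (seq bool)) : a != b ->
  has [in map (cons a) s] (map (cons b) t) = false.
Proof.
move=> ab; apply/hasP => [[_ /mapP[x _ ->] /mapP[y _ [E _]]]].
by rewrite E eqxx in ab.
Qed.

(** Follow the first path in half [a], cross the matching from [v] to [vq_twist v], and follow the
    second path in the other half. As lengths count vertices, they simply add. *)
Lemma simple_path_cross a u v l0 l1 : 2 <= size u -> 2 <= size v ->
    simple_path u v l0 -> simple_path (vq_twist v) (vq_twist u) l1 ->
  simple_path (a :: u) (~~ a :: vq_twist u) (l0 + l1).
Proof.
move=> su sv [s [ps ls us <-]] [t [pt lt ut <-]].
exists (map (cons a) s ++ map (cons (~~ a)) (vq_twist v :: t)); split.
- rewrite cat_path path_map_cons ?ps /=; last lia.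
  rewrite last_map ls vq_adj_cross // eqxx path_map_cons //.
  by rewrite size_vq_twist; lia.
- by rewrite last_cat /= last_map lt.
- rewrite -cat_cons -map_cons cat_uniq has_map_cons_neq; last by case: (a).
  by rewrite !map_inj_uniq ?us //; move=> ? ? [].
- by rewrite size_cat !size_map /= addSn.
Qed.

Lemma simple_path_detour a x y l0 l1 : 3 <= size x -> 4 <= l0 ->
    simple_path x y l0 ->
    (forall u v, size u = size x -> vq_adj u v -> simple_path u v l1) ->
  simple_path (a :: x) (a :: y) (l0 + l1).
Proof.
move=> sx l0_ge4 [s [ps ls us sl]] Hl1.
(* One of the first two edges is preserved by the twist: two consecutive flips of the first bit
   would lead back to [x]. *)
have [s1 [v [s2 [sE tw]]]] : exists s1 v s2, s = s1 ++ v :: s2 /\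
    vq_adj (vq_twist (last x s1)) (vq_twist v).
  case: s ps us sl {ls} => [|z1 [|z2 s]] /=; try lia.
  case/and3P=> xz zz _ us _.
  have [tw|z1E] := vq_adj_twist _ _ sx xz; first by exists [::], z1, (z2 :: s).
  have sz : 3 <= size z1 by rewrite -(vq_adj_size _ _ xz).
  have [tw|z2E] := vq_adj_twist _ _ sz zz; first by exists [:: z1], z2, s.
  have: x = z2 by rewrite z2E z1E; case: (x) sx => [|c w] //=; rewrite negbK.
  by move=> xE; rewrite xE !inE eqxx orbT in us.
set u := last x s1 in tw; subst s.
move: ps; rewrite cat_path /= -/u => /and3P[ps1 uv ps2].
have su : size u = size x.
  have /allP := path_size _ _ ps1; rewrite /u.
  case: (s1) => // z r H; apply/eqP/H; exact: (mem_last z r).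
have sv : size v = size x by rewrite -(vq_adj_size _ _ uv).
have [||t [pt lt ut <-]] := Hl1 (vq_twist u) (vq_twist v); rewrite ?size_vq_twist //.
exists (map (cons a) s1 ++ map (cons (~~ a)) (vq_twist u :: t) ++ map (cons a) (v :: s2)).
split.
- rewrite cat_path path_map_cons ?ps1 /=; last lia.
  rewrite last_map -/u vq_adj_cross ?eqxx /=; last lia.
  rewrite cat_path path_map_cons ?pt ?size_vq_twist; last lia.
  rewrite last_map lt /= -{2}[a]negbK vq_adj_cross ?size_vq_twist; last lia.
  by rewrite vq_twistK eqxx path_map_cons ?ps2 // sv; lia.
- by rewrite !last_cat /= last_map; move: ls; rewrite last_cat /= => ->.
- rewrite -cat_cons -map_cons.
  (* Moving the detour to the front leaves the original path in one piece in half [a]. *)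
  rewrite uniq_catCA -map_cat cat_uniq.
  rewrite has_map_cons_neq; last by case: (a).
  by rewrite !map_inj_uniq ?ut //; move=> ? ? [].
- by move: sl; rewrite !size_cat !size_map /=; lia.
Qed.

(** * Exhaustive search in small varietal hypercubes *)

Fixpoint strings n : seq (seq bool) :=
  if n is m.+1 then map (cons false) (strings m) ++ map (cons true) (strings m)
  else [:: [::]].

Lemma mem_strings n x : size x = n -> x \in strings n.
Proof.
elim: n x => [|n IHn] [|a x] // [/IHn xn].
by rewrite mem_cat; case: a; rewrite (map_f (cons _) xn) ?orbT.
Qed.

(** Here [k] counts the edges still to be walked. Under [vm_compute] the second argument of [&&]
    would be evaluated in every case; the [if] prunes the illegal steps. *)
Fixpoint search V k visited (x y : seq bool) : bool :=
  if k is k'.+1 then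
    has (fun z => if vq_adj x z && (z \notin visited)
                  then search V k' (z :: visited) z y else false) V
  else x == y.

Lemma search_sound V k visited x y : search V k visited x y ->
  exists s, [/\ path vq_adj x s, last x s = y, uniq s,
                ~~ has [in visited] s & size s = k].
Proof.
elim: k visited x => [|k IHk] visited x /=.
  by move/eqP=> xy; exists [::].
case/hasP=> z _; case: ifP => // /andP[xz zN] /IHk[s [ps ls us hs <-]].
exists (z :: s); split=> //=; first by rewrite xz.
- rewrite us andbT; apply: contra hs => zs; apply/hasP; exists z => //.
  exact: mem_head.
- rewrite negb_or zN; apply: contra hs => /hasP[w ws wv].
  by apply/hasP; exists w => //; apply: mem_behead.
Qed.

Definition all_edges_search n k :=
  let V := strings n in
  all (fun x => all (fun y =>
    if vq_adj x y then search V k [:: x] x y else true) V) V.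

Lemma all_edges_searchP n k x y :
  all_edges_search n k -> size x = n -> vq_adj x y -> simple_path x y k.+1.
Proof.
move=> /allP H sx xy; have sy := vq_adj_size _ _ xy.
have /allP/(_ y) := H x (mem_strings _ _ sx).
rewrite mem_strings -?sy // xy => /(_ isT) /search_sound[s [ps ls us hs <-]].
exists s; split=> //=; rewrite us andbT; apply: contra hs => xs.
by apply/hasP; exists x; rewrite ?inE.
Qed.

Lemma simple_path_VQ2 x y : size x = 2 -> vq_adj x y -> simple_path x y 4.
Proof. by apply: all_edges_searchP; vm_compute. Qed.

Lemma simple_path_VQ3 x y l : size x = 3 -> vq_adj x y ->
  l \in [:: 4; 6; 7; 8] -> simple_path x y l.
Proof.
move=> sx xy; rewrite !inE => /or4P[]/eqP->;
  by apply: (all_edges_searchP 3) => //; vm_compute.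
Qed.

Lemma simple_path_VQ4_7 x y : size x = 4 -> vq_adj x y -> simple_path x y 7.
Proof. by apply: all_edges_searchP; vm_compute. Qed.

(** * Simple paths joining adjacent vertices *)

Lemma vq_adj_cat q s t : 0 < size s -> vq_adj s t -> vq_adj (q ++ s) (q ++ t).
Proof.
move=> ss st; elim: q => //= a q IHq; rewrite -/(vq_adj (a :: _) (a :: _)).
by rewrite vq_adj_cons // size_cat; lia.
Qed.

Lemma simple_path_cross_7 a u : 3 <= size u ->
  simple_path (a :: u) (~~ a :: vq_twist u) 7.
Proof.
move=> su; case d3: (3 %| (size u).+1).
  (* The first three bits with the tail [w] fixed span a copy of $VQ_3$: the dimensions
     [(size w).+3], [(size w).+2], [(size w).+1] have the same residues modulo 3 as 3, 2, 1. *)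
  case: u su d3 => [|b [|c w]] //= sw d3; rewrite d3.
  have d2 : 3 %| (size w).+2 = false by lia.
  have d1 : 3 %| (size w).+1 = false by lia.
  have {}sw : 0 < size w by lia.
  apply: (simple_path_map (cat^~ w) 3 [:: a; b; c] [:: ~~ a; b; c (+) b]) => //.
  - move=> s t E; have := congr1 size E; rewrite !size_cat => /addIn st.
    by move/eqP: E; rewrite eqseq_cat // => /andP[/eqP].
  - move=> [|x1 [|x2 [|x3 [|]]]] // v _ xv.
    case: v xv (vq_adj_size _ _ xv) => [|y1 [|y2 [|y3 [|]]]] // + _.
    rewrite /= ![vq_adj [:: _, _ & _] _]vq_adjE // [vq_adj (_ :: w) _]vq_adjE //.
    rewrite /vq_cross /= d3 d2 d1.
    by move: x1 x2 x3 y1 y2 y3 => [] [] [] [] [] []; rewrite /= ?drop0 ?take0 ?eqxx.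
  - by apply: simple_path_VQ3; move: a b c => [] [] [].
have twE : vq_twist u = u by case: (u) d3 => [|b [|c w]] //= ->.
rewrite twE; set q := take (size u - 3) u; set s := drop (size u - 3) u.
have ss : size s = 3 by rewrite size_drop; lia.
have uE : u = q ++ s by rewrite cat_take_drop.
have sq : size u = size q + 3 by rewrite uE size_cat ss.
(* Inserting the fixed block [q] after the first bit embeds $VQ_4$: the last three bits form $VQ_3$,
   and the first bit is flipped without twist in both cubes. *)
pose f (t : seq bool) := if t is c :: r then c :: q ++ r else [::].
rewrite uE; apply: (simple_path_map f 4 (a :: s) (~~ a :: s)) => /=; last first.
- apply: simple_path_VQ4_7; first by rewrite /= ss.
  by rewrite vq_adj_cross ?ss //; case: (s) ss => [|? [|? [|? []]]].
- by rewrite ss.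
- move=> [|c r] // v [sr] cv; have := vq_adj_size _ _ cv.
  case: v cv => [|d r'] // cv [srr]; have [dc|dc] := eqVneq d c.
    move: cv; rewrite dc /f !vq_adj_cons ?size_cat ?sr; try lia.
    by apply: vq_adj_cat; rewrite sr.
  have dE : d = ~~ c by case: c d dc {cv} => [] [].
  move: cv; rewrite dE /f !vq_adj_cross ?size_cat ?sr; try lia.
  have twN t : size t = 3 \/ size t = size u -> vq_twist t = t.
    by case: t => [|? [|? t]] //=; case: ifP => //; lia.
  by rewrite !twN ?size_cat; [move/eqP-> | lia | lia].
by move=> [|c r] [|d r'] // [-> /eqP]; rewrite eqseq_cat // eqxx => /eqP->.
Qed.

Lemma simple_path_VQ n x y l : 3 <= n -> size x = n -> vq_adj x y ->
  l \in [:: 2; 4] \/ 6 <= l <= 2 ^ n -> simple_path x y l.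
Proof.
move=> n3; elim: n n3 x y l => // n IHn n3 x y l sx xy Hl.
have [n_eq|n_ge] : n = 2 \/ 3 <= n by lia.
  subst n; case: Hl => [|Hl]; last by apply: simple_path_VQ3; rewrite ?inE; lia.
  rewrite !inE => /orP[]/eqP->; first exact: simple_path_adj.
  exact: simple_path_VQ3.
have {}IHn := IHn n_ge.
have [m_ge8 mE] : 8 <= 2 ^ n /\ 2 ^ n.+1 = 2 ^ n + 2 ^ n.
  by rewrite expnS mul2n addnn; split=> //; rewrite -[8]/(2 ^ 3) leq_exp2l.
rewrite mE {mE} in Hl; set m := 2 ^ n in IHn m_ge8 Hl.
have {}Hl : [\/ l = 2, l = 4 | 6 <= l <= m + m].
  by case: Hl => [|Hl]; [rewrite !inE => /orP[]/eqP->|]; constructor.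
have ok k : [\/ k = 2, k = 4 | 6 <= k <= m] -> k \in [:: 2; 4] \/ 6 <= k <= m.
  by case=> [->|->|]; auto.
have sxy := vq_adj_size _ _ xy.
case: x y sx sxy xy => [|a u] [|b v] // [su] [suv].
have [->|] := eqVneq b a.
  rewrite vq_adj_cons ?su; last lia.
  move=> uv.
  have [l_le|l_gt] := leqP l m.
    apply: (simple_path_map (cons a) n) => //; first by move=> ? ? [].
      by move=> s t ss st; rewrite vq_adj_cons //; lia.
    by apply: IHn => //; apply: ok; case: Hl => Hl; [constructor 1|constructor 2|constructor 3]; lia.
  have [l0 [l1 [-> l0P l1P]]] : exists l0 l1, [/\ l = l0 + l1, 6 <= l0 <= m
      & [\/ l1 = 2, l1 = 4 | 6 <= l1 <= m]].
    (* Taking [l0 = m] would leave 1, 3 or 5 for [l1] when [l - m] is one of these; then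
       [l0 = m - 1] leaves 2, 4 or 6. Since [m] is at least 8, [m - 1] is an allowed length. *)
    have [E|[E|[E|[E|[E|E]]]]] : l = m + 1 \/ l = m + 2 \/ l = m + 3 \/ l = m + 4
      \/ l = m + 5 \/ m + 6 <= l by lia.
    - by exists (m - 1), 2; split; [lia|lia|constructor].
    - by exists m, 2; split; [lia|lia|constructor].
    - by exists (m - 1), 4; split; [lia|lia|constructor].
    - by exists m, 4; split; [lia|lia|constructor].
    - by exists (m - 1), 6; split; [lia|lia|constructor 3; lia].
    - by exists m, (l - m); split; [lia|lia|constructor 3; case: Hl; lia].
  apply: simple_path_detour; [lia|lia| |].
    by apply: IHn => //; right.
  by move=> s t ss st; apply: IHn => //; [rewrite ss | apply: ok].
move=> ba; have {ba}-> : b = ~~ a by case: a b ba => [] [].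
rewrite vq_adj_cross ?su; last lia.
move=> /eqP vE; subst v.
have cr := vq_adj_cross a u (vq_twist u).
have [E2|[E7|Hl']] : l = 2 \/ l = 7 \/ (l <> 2 /\ l <> 7) by lia.
- by rewrite E2; apply: simple_path_adj; rewrite cr ?eqxx; lia.
- by rewrite E7; apply: simple_path_cross_7; lia.
have [l0 [l1 [-> l0P l1P]]] : exists l0 l1, [/\ l = l0 + l1,
    [\/ l0 = 2, l0 = 4 | 6 <= l0 <= m]
    & [\/ l1 = 2, l1 = 4 | 6 <= l1 <= m]].
  have [E|[E|[E|[E|[E|E]]]]] : l = 4 \/ l = 6 \/ 8 <= l <= m + 2 \/ l = m + 3
    \/ l = m + 5 \/ (m + 4 <= l <= m + m /\ l <> m + 5) by case: Hl; lia.
  - by exists 2, 2; split; [lia|constructor..].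
  - by exists 4, 2; split; [lia|constructor..].
  - by exists (l - 2), 2; split; [lia|constructor 3; lia|constructor].
  - by exists (m - 1), 4; split; [lia|constructor 3; lia|constructor].
  - by exists (m - 1), 6; split; [lia|constructor 3; lia|constructor 3; lia].
  - have [E'|E'] : l = m + 4 \/ m + 6 <= l by lia.
      by exists m, 4; split; [lia|constructor 3; lia|constructor].
    by exists m, (l - m); split; [lia|constructor 3; lia|constructor 3; lia].
(* Flipping the last bit of [u] is always an edge, and the twist preserves it because [u] has at
   least three bits and the twist only touches the second one. *)
have [v [uv tw]] : exists v, vq_adj u v /\ vq_adj (vq_twist v) (vq_twist u).
  case/lastP: u su {cr suv Hl'} => [|p c]; first by move=> /=; lia.
  rewrite size_rcons => su; exists (rcons p (~~ c)).
  have flip q d d' : d != d' -> vq_adj (rcons q d) (rcons q d').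
    by rewrite -!cats1 => dd'; apply: vq_adj_cat => //=; case: d d' dd' => [] [].
  have Nc : ~~ c != c by case: (c).
  split; first by apply: flip; rewrite eq_sym.
  case: p su => [|p0 [|p1 p]] /=; try lia.
  move=> _; rewrite !size_rcons; case: ifP => _.
    exact: (flip [:: p0, p1 (+) p0 & p]).
  exact: (flip [:: p0, p1 & p]).
have sv := vq_adj_size _ _ uv.
apply: (simple_path_cross a u v); [lia|lia| |].
  by apply: IHn => //; apply: ok.
by apply: IHn; rewrite ?size_vq_twist; [lia| |apply: ok].
Qed.

(** * From simple paths to cycles on tuples *)

Lemma map_tval n (s : seq (seq bool)) : all (fun x => size x == n) s ->
  exists t : seq (n.-tuple bool), s = map val t.
Proof.
elim: s => [|x s IHs] /=; first by exists [::].
by case/andP=> sx /IHs[t ->]; exists (Tuple sx :: t).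
Qed.

(** The edge from [x] to [y] closes the path. Moving its final vertex [x] to the front gives a cycle
    with the same number [l] of vertices, in which [y] follows [x]. *)
Lemma simple_path_edge_on_cycle n (x y : n.-tuple bool) l : 3 <= l ->
  VQ n x y -> simple_path y x l -> edge_on_cycle_of_length (VQ n) x y l.
Proof.
move=> l3 xy [s [ps ls us sl]].
have [t tE] : exists t : seq (n.-tuple bool), s = map val t.
  by apply: map_tval; have := path_size _ _ ps; rewrite size_tuple.
subst s; case/lastP: t ps ls us sl => [|t z]; first by move=> /=; lia.
rewrite last_map last_rcons => ps /val_inj zx; subst z.
rewrite -map_cons (map_inj_uniq val_inj) size_map size_rcons => us sl.
have {}ps : path (VQ n) y (rcons t x) by move: ps; rewrite path_map.
have nx : next (x :: y :: t) x = y by rewrite /= eqxx.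
exists (x :: y :: t); split=> //; last by split; [rewrite !inE eqxx ?orbT..|left].
split; first by move: l3; rewrite -sl.
apply/andP; split; first by rewrite /= xy.
by move: us; rewrite -rcons_cons rcons_uniq.
Qed.

Theorem theorem3p1 (n : nat) (hn : 2 <= n) :
  (forall x y : n.-tuple bool, VQ n x y ->
   forall l : nat, 4 <= l <= 2 ^ n -> l <> 5 ->
   edge_on_cycle_of_length (VQ n) x y l)
  /\ (3 <= n -> edge_pancyclic (VQ n) 6).
Proof.
have H (x y : n.-tuple bool) : VQ n x y -> forall l, 4 <= l <= 2 ^ n -> l <> 5 ->
    edge_on_cycle_of_length (VQ n) x y l.
  move=> xy l lP l5; apply: simple_path_edge_on_cycle => //; first lia.
  have yx : vq_adj y x by rewrite -/(VQ n y x) VQ_sym.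
  have [n2|n3] : n = 2 \/ 3 <= n by lia.
    have -> : l = 4 by move: lP; rewrite n2; lia.
    by apply: simple_path_VQ2; rewrite // size_tuple.
  apply: (simple_path_VQ n) => //; first by rewrite size_tuple.
  by rewrite !inE; lia.
split=> // _ x y xy k; rewrite card_tuple card_bool => kP.
by apply: H => //; lia.
Qed.
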